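(* Let $K$ be a field, let $A=\bigoplus_{i\ge 0}A_i$ be a connected graded $K$-algebra, and let $n\ge 0$. If $A$ is left-$FP_n$ or right-$FP_n$, then $A$ is bi-$FP_n$.
   Context: A graded $K$-algebra is a $K$-algebra $A=\bigoplus_{i\ge0}A_i$ (direct sum of $K$-subspaces) with $A_iA_j\subseteq A_{i+j}$; it is connected if $A_0$ has basis $\{1_A\}$. Its standard augmentation $\varepsilon:A\to K$ sends $1_A\mapsto 1_K$ and $A_i\mapsto 0$ for $i>0$. A module is of type $FP_n$ if there is an exact sequence $0\leftarrow M\leftarrow P_0\leftarrow\cdots\leftarrow P_n$ with $P_0,\dots,P_n$ finitely generated free modules (for graded modules it makes no difference whether the resolution is required to be graded or not). $A$ is left-$FP_n$ (resp. right-$FP_n$) if $K$, as a left (resp. right) $A$-module via $\varepsilon$, is of type $FP_n$. An $(A,A)$-bimodule is an abelian group with left and right $A$-actions satisfying $(am)b=a(mb)$ and $km=mk$ for $k\in K$; a free bimodule of rank $r$ is a direct sum of $r$ copies of $A\otimes_K A$ with action $a(u\otimes v)b=au\otimes vb$. $A$ is bi-$FP_n$ if $A$, as a bimodule by left and right multiplication, has an exact sequence $0\leftarrow A\leftarrow F_0\leftarrow\cdots\leftarrow F_n$ with $F_0,\dots,F_n$ finitely generated free $(A,A)$-bimodules. *)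

(* Defs.v *)
From HB Require Import structures.
From mathcomp Require Import all_boot all_order all_algebra.
Set Implicit Arguments. Unset Strict Implicit. Unset Printing Implicit Defensive.
Import GRing.Theory.
Local Open Scope ring_scope.

Definition is_subspace (K : fieldType) (A : algType K) (S : A -> Prop) : Prop :=
  S 0 /\ forall (k : K) (x y : A), S x -> S y -> S (k *: x + y).

Definition graded_algebra (K : fieldType) (A : algType K)
    (G : nat -> A -> Prop) : Prop :=
  [/\
      forall i, is_subspace (G i),
      forall a : A, exists (N : nat) (x : nat -> A),
        (forall i, G i (x i)) /\ a = \sum_(i < N) x i,
      forall (N : nat) (x : nat -> A),
        (forall i, G i (x i)) -> \sum_(i < N) x i = 0 ->
        forall i, (i < N)%N -> x i = 0
    &
      forall i j (x y : A), G i x -> G j y -> G (i + j)%N (x * y) ].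

Definition connected_grading (K : fieldType) (A : algType K)
    (G : nat -> A -> Prop) : Prop :=
  [/\ G 0%N 1, (1 : A) != 0 & forall x : A, G 0%N x -> exists k : K, x = k *: 1 ].

(* eps is the standard augmentation: 1_A |-> 1_K, A_i |-> 0 for i > 0,
   i.e. eps a is the coefficient of 1_A in the degree-0 component of a. *)
Definition standard_augmentation (K : fieldType) (A : algType K)
    (G : nat -> A -> Prop) (eps : A -> K) : Prop :=
  forall a : A, exists (N : nat) (x : nat -> A),
    (forall i, G i.+1 (x i)) /\ a = eps a *: 1 + \sum_(i < N) x i.

(* left-FP_n : K, as a left A-module via eps (a.k = eps a * k), has a  *)
(* resolution 0 <- K <- P_0 <- P_1 <- ... <- P_n, exact at K, P_0, ...,*)
(* P_(n-1), with P_k = A^(r k) finitely generated free left modules.   *)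
(* Elements of A^r are row vectors 'rV[A]_r (left action a *: v), and  *)
(* left A-linear maps A^s -> A^r are v |-> v *m M with M : 'M_(s, r).  *)

Definition left_FPn (K : fieldType) (A : algType K) (eps : A -> K) (n : nat)
  : Prop :=
  exists (r : nat -> nat) (p : 'rV[A]_(r 0%N) -> K)
         (d : forall k, 'M[A]_(r k.+1, r k)),
  [/\
      forall u v, p (u + v) = p u + p v,
      forall (a : A) v, p (a *: v) = eps a * p v,
      forall k : K, exists v, p v = k,
      (0 < n)%N -> forall v, p v = 0 <-> exists w, v = w *m d 0%N
    &
      forall k, (k.+1 < n)%N ->
        forall v : 'rV[A]_(r k.+1), v *m d k = 0 <-> exists w, v = w *m d k.+1 ].

(* right-FP_n : same with right modules.  Elements of the free right   *)
(* module A^r are column vectors 'cV[A]_r with right action            *)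
(* v . a = v *m a%:M, and right A-linear maps A^s -> A^r are           *)
(* v |-> M *m v with M : 'M_(r, s).  K is a right module via           *)
(* k . a = k * eps a.                                                  *)
Definition right_FPn (K : fieldType) (A : algType K) (eps : A -> K) (n : nat)
  : Prop :=
  exists (r : nat -> nat) (p : 'cV[A]_(r 0%N) -> K)
         (d : forall k, 'M[A]_(r k, r k.+1)),
  [/\ forall u v, p (u + v) = p u + p v,
      forall (a : A) v, p (v *m a%:M) = p v * eps a,
      forall k : K, exists v, p v = k,
      (0 < n)%N -> forall v, p v = 0 <-> exists w, v = d 0%N *m w
    & forall k, (k.+1 < n)%N ->
        forall v : 'cV[A]_(r k.+1), d k *m v = 0 <-> exists w, v = d k.+1 *m w ].

Record bimod_data (K : fieldType) (A : algType K) := BimodData {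
  bm_sort :> zmodType;
  bm_l : A -> bm_sort -> bm_sort;
  bm_r : bm_sort -> A -> bm_sort }.

Definition is_bimod (K : fieldType) (A : algType K) (M : bimod_data A) : Prop :=
  [/\
      [/\ (forall a (m m' : M), bm_l a (m + m') = bm_l a m + bm_l a m')
        , (forall a b (m : M), bm_l (a + b) m = bm_l a m + bm_l b m)
        , (forall m : M, bm_l 1 m = m)
        & (forall a b (m : M), bm_l (a * b) m = bm_l a (bm_l b m)) ],
      [/\ (forall b (m m' : M), bm_r (m + m') b = bm_r m b + bm_r m' b)
        , (forall a b (m : M), bm_r m (a + b) = bm_r m a + bm_r m b)
        , (forall m : M, bm_r m 1 = m)
        & (forall a b (m : M), bm_r m (a * b) = bm_r (bm_r m a) b) ],
      (forall a b (m : M), bm_r (bm_l a m) b = bm_l a (bm_r m b))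
    &
      (forall (k : K) (m : M), bm_l (k *: 1) m = bm_r m (k *: 1)) ].

Definition bimod_hom (K : fieldType) (A : algType K) (M N : bimod_data A)
    (f : M -> N) : Prop :=
  [/\ forall m m' : M, f (m + m') = f m + f m',
      forall a (m : M), f (bm_l a m) = bm_l a (f m)
    & forall b (m : M), f (bm_r m b) = bm_r (f m) b ].

(* F is a free bimodule with (finite) basis e : 'I_r -> F, i.e. F is   *)
(* isomorphic to a direct sum of r copies of A (x)_K A with e i the    *)
(* generators 1 (x) 1; stated by the defining universal property of    *)
(* free bimodules (A (x)_K A is not available in the library).         *)
Definition free_bimod (K : fieldType) (A : algType K) (F : bimod_data A)
    (r : nat) (e : 'I_r -> F) : Prop :=
  is_bimod F /\
  forall (N : bimod_data A), is_bimod N ->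
  forall nv : 'I_r -> N,
    exists f : F -> N,
    [/\ bimod_hom f, (forall i, f (e i) = nv i)
      & forall g : F -> N, bimod_hom g -> (forall i, g (e i) = nv i) ->
          forall x, g x = f x ].

Definition regular_bimod (K : fieldType) (A : algType K) : bimod_data A :=
  @BimodData K A A (fun a m => a * m) (fun m b => m * b).

Definition bi_FPn (K : fieldType) (A : algType K) (n : nat) : Prop :=
  exists (r : nat -> nat) (F : nat -> bimod_data A)
         (e : forall k, 'I_(r k) -> F k)
         (p : F 0%N -> regular_bimod A) (d : forall k, F k.+1 -> F k),
  [/\
      forall k, (k <= n)%N -> free_bimod (e k),
      bimod_hom p /\ forall k, (k < n)%N -> bimod_hom (d k),
      forall a : A, exists x, p x = a,
      (0 < n)%N -> forall x, p x = 0 <-> exists y, x = d 0%N y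
    &
      forall k, (k.+1 < n)%N -> forall x, d k x = 0 <-> exists y, x = d k.+1 y ].

(* Main.v *)
Require Import Defs.
From HB Require Import structures.
From mathcomp Require Import all_boot all_order all_algebra.
From mathcomp Require Import generic_quotient boolp classical_sets.

(** Build a bimodule resolution [F_0 <- F_1 <- ...] of [A] one syzygy at a time.
    Each syzygy [Z] of [F_k] is a graded sub-bimodule that splits off as a right
    module, because [A] is right free and so are all the [F_k].  Hence reduction
    modulo the right action of the augmentation ideal turns the bimodule
    resolution into a resolution of [K] by finitely generated free left modules,
    with the reduction of [Z] as its syzygy.  Comparing it with the given
    resolution of [K] up to homotopy (Schanuel), that reduction is finitely
    generated, and by a one-sided graded Nakayama argument so is [Z] as a
    bimodule, which yields [F_(k+1)].  The right-handed case is the left-handed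
    one for the opposite algebra. *)

Set Implicit Arguments.
Unset Strict Implicit.
Unset Printing Implicit Defensive.
Import GRing.Theory.
Local Open Scope ring_scope.

Section LinearLift.

Context (K : fieldType) (V X Y : lmodType K) (d : X -> Y) (g : V -> Y).
Hypothesis d_lin : forall k x x', d (k *: x + x') = k *: d x + d x'.
Hypothesis g_lin : forall k v v', g (k *: v + v') = k *: g v + g v'.
Hypothesis g_im : forall v, exists x, d x = g v.

(* Graphs of lifts of [g] through [d] defined on a subspace of [V]; the empty
   graph is allowed, so that unions of chains need no special case. *)
Definition partial_lift (S : set (V * X)) : Prop :=
  [/\ forall k p q, S p -> S q -> S (k *: p.1 + q.1, k *: p.2 + q.2),
      forall p, S p -> d p.2 = g p.1
    & forall x, S (0, x) -> x = 0].

Lemma partial_lift_uniq S v x x' :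
  partial_lift S -> S (v, x) -> S (v, x') -> x = x'.
Proof.
case=> SD _ S0 Sx Sx'; have /= := SD (-1) _ _ Sx' Sx.
by rewrite !scaleN1r addNr => /S0 /eqP; rewrite addrC subr_eq0 => /eqP.
Qed.

Lemma partial_lift_chain (F : set (set (V * X))) :
  (F `<=` partial_lift)%classic -> total_on F subset ->
  partial_lift (\bigcup_(S in F) S)%classic.
Proof.
move=> sFP totF; split.
- move=> k p q [S FS Sp] [S' FS' Sq]; case: (totF _ _ FS FS') => sub.
    by exists S' => //; case: (sFP _ FS') => SD _ _; apply: SD => //; apply: sub.
  by exists S => //; case: (sFP _ FS) => SD _ _; apply: SD => //; apply: sub.
- by move=> p [S FS Sp]; case: (sFP _ FS) => _ + _; apply.
- by move=> x [S FS Sp]; case: (sFP _ FS) => _ _; apply.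
Qed.

Lemma partial_lift_total :
  exists S, partial_lift S /\ forall v, exists x, S (v, x).
Proof.
have [S [plS maxS]] := Zorn_bigcup partial_lift_chain.
have [SD Sd S0] := plS.
have d0 : d 0 = 0 by have := d_lin (-1) 0 0; rewrite !scaleN1r !addNr.
have g0 : g 0 = 0 by have := g_lin (-1) 0 0; rewrite !scaleN1r !addNr.
pose S1 p := S p \/ p = (0, 0).
have S1D k p q : S1 p -> S1 q -> S1 (k *: p.1 + q.1, k *: p.2 + q.2).
  move=> [Sp|->] [Sq|->] /=; rewrite ?scaler0 ?addr0 ?add0r.
  - by left; apply: SD.
  - by left; have := SD (k - 1) _ _ Sp Sp; rewrite !scalerBl !scale1r !subrK.
  - by left; case: (q) Sq.
  - by right.
have S1d p : S1 p -> d p.2 = g p.1 by case=> [/Sd //|->]; rewrite d0.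
have S1v x : S1 (0, x) -> x = 0 by case=> [/S0 //|[]].
exists S1; split=> // v; apply: contrapT => vS.
have [x0 dx0] := g_im v.
pose S2 : set (V * X) :=
  fun p => exists k q, S1 q /\ p = (k *: v + q.1, k *: x0 + q.2).
apply: (maxS S2); first split.
- move=> p Sp; exists 0, p; rewrite !scale0r !add0r.
  by split; [left | case: (p)].
- move=> S21; apply: vS; exists x0; left; apply: S21.
  by exists 1, (0, 0); split; [right | rewrite !scale1r !addr0].
- split.
  + move=> k _ _ [l [p [Sp ->]]] [m [q [Sq ->]]] /=.
    exists (k * l + m), (k *: p.1 + q.1, k *: p.2 + q.2); split; first exact: S1D.
    by congr pair; rewrite /= scalerDr scalerDl !scalerA addrACA.
  + move=> _ [k [p [Sp ->]]] /=; rewrite d_lin g_lin dx0; congr (_ + _).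
    exact: S1d.
  + move=> x [k [p [Sp [e ->]]]]; have [k0|k0] := eqVneq k 0.
      by move: e Sp; rewrite k0 !scale0r !add0r; case: p => ? ? /= <- /S1v.
    case: vS; exists (- k^-1 *: p.2).
    have := S1D (- k^-1) _ _ Sp (or_intror erefl); rewrite !addr0.
    suff -> : - k^-1 *: p.1 = v by [].
    apply: (scalerI k0); rewrite scalerA mulrN divff // scaleN1r.
    by apply/eqP; rewrite eq_sym -addr_eq0 -e.
Qed.

Lemma linear_lift : exists phi : V -> X,
  (forall k v v', phi (k *: v + v') = k *: phi v + phi v') /\
  forall v, d (phi v) = g v.
Proof.
have [S [plS /choice[phi Sphi]]] := partial_lift_total; have [SD Sd _] := plS.
exists phi; split=> [k v v'|v]; last exact: Sd (Sphi v).
by apply: (partial_lift_uniq plS (Sphi _)); apply: (SD k _ _ (Sphi v) (Sphi v')).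
Qed.

End LinearLift.

Section BiTensor.

Context (K : fieldType) (A : algType K) (r : nat).

Definition balanced (N : zmodType) (beta : 'I_r -> A -> A -> N) : Prop :=
  [/\ forall i a a' b, beta i (a + a') b = beta i a b + beta i a' b,
      forall i a b b', beta i a (b + b') = beta i a b + beta i a b'
    & forall i (k : K) a b, beta i (k *: a) b = beta i a (k *: b)].

Definition word_eval (N : zmodType) (beta : 'I_r -> A -> A -> N)
    (s : seq ('I_r * A * A)) : N :=
  \sum_(t <- s) beta t.1.1 t.1.2 t.2.

(* The quotient by this relation is the direct sum of [r] copies of the tensor
   square of [A] over [K]: the universal property of the tensor product, read
   impredicatively, serves as the definition of equality. *)
Definition word_eq (s t : seq ('I_r * A * A)) : bool :=
  `[< forall (N : zmodType) (beta : 'I_r -> A -> A -> N), balanced beta ->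
      word_eval beta s = word_eval beta t >].

Lemma word_eq_refl : reflexive word_eq.
Proof. by move=> s; apply/asboolP. Qed.

Lemma word_eq_sym : symmetric word_eq.
Proof.
by move=> s t; apply/asboolP/asboolP => st N beta beta_bal; rewrite st.
Qed.

Lemma word_eq_trans : transitive word_eq.
Proof.
move=> t s u /asboolP st /asboolP tu; apply/asboolP => N beta beta_bal.
by rewrite st // tu.
Qed.

Canonical word_equiv := EquivRel word_eq word_eq_refl word_eq_sym word_eq_trans.

Definition bitensor := {eq_quot word_equiv}%qT.

HB.instance Definition _ := Choice.on bitensor.

Definition bitensor_of (s : seq ('I_r * A * A)) : bitensor :=
  (\pi_({eq_quot word_equiv}%qT) s)%qT.

Definition bilift (N : zmodType) (beta : 'I_r -> A -> A -> N) (x : bitensor) : N :=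
  word_eval beta (repr x).

Lemma bilift_of (N : zmodType) (beta : 'I_r -> A -> A -> N) s :
  balanced beta -> bilift beta (bitensor_of s) = word_eval beta s.
Proof.
move=> beta_bal; rewrite /bilift.
suff /asboolP -> : word_eq (repr (bitensor_of s)) s by [].
by apply/eqmodP; rewrite reprK.
Qed.

Lemma bitensor_ofK x : bitensor_of (repr x) = x.
Proof. exact: reprK. Qed.

Lemma bitensor_eq (x y : bitensor) :
  (forall (N : zmodType) (beta : 'I_r -> A -> A -> N), balanced beta ->
    bilift beta x = bilift beta y) -> x = y.
Proof.
move=> xy; rewrite -(bitensor_ofK x) -(bitensor_ofK y).
by apply/eqmodP; apply/asboolP.
Qed.

Definition bit_add (x y : bitensor) := bitensor_of (repr x ++ repr y).
Definition bit_scale (k : K) (x : bitensor) :=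
  bitensor_of [seq (t.1.1, k *: t.1.2, t.2) | t <- repr x].

Lemma bilift_add (N : zmodType) (beta : 'I_r -> A -> A -> N) x y : balanced beta ->
  bilift beta (bit_add x y) = bilift beta x + bilift beta y.
Proof. by move=> beta_bal; rewrite bilift_of // /word_eval big_cat. Qed.

Lemma balanced_scale (N : zmodType) k (beta : 'I_r -> A -> A -> N) : balanced beta ->
  balanced (fun i a b => beta i (k *: a) b).
Proof.
case=> D1 D2 Z; split=> [i a a' b|i a b b'|i l a b] //.
  by rewrite scalerDr D1.
by rewrite scalerA mulrC -scalerA Z.
Qed.

Lemma bilift_scale (N : zmodType) (beta : 'I_r -> A -> A -> N) k x : balanced beta ->
  bilift beta (bit_scale k x) = bilift (fun i a b => beta i (k *: a) b) x.
Proof. by move=> beta_bal; rewrite bilift_of // /word_eval big_map. Qed.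

Lemma bilift_zero (N : zmodType) (beta : 'I_r -> A -> A -> N) : balanced beta ->
  bilift beta (bitensor_of [::]) = 0.
Proof. by move=> beta_bal; rewrite bilift_of // /word_eval big_nil. Qed.

Lemma bilift_opp (N : zmodType) (beta : 'I_r -> A -> A -> N) x : balanced beta ->
  bilift beta (bit_scale (-1) x) = - bilift beta x.
Proof.
move=> beta_bal; rewrite bilift_scale // /bilift /word_eval -sumrN.
apply: eq_bigr => t _; apply/eqP; rewrite -addr_eq0; case: beta_bal => D1 _ _.
rewrite -D1 scaleN1r addNr; apply/eqP/(@addrI _ (beta t.1.1 0 t.2)).
by rewrite -D1 !addr0.
Qed.

Lemma bit_addA : associative bit_add.
Proof. by move=> x y z; apply: bitensor_eq => N b b_bal; rewrite !bilift_add // addrA. Qed.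
Lemma bit_addC : commutative bit_add.
Proof. by move=> x y; apply: bitensor_eq => N b b_bal; rewrite !bilift_add // addrC. Qed.
Lemma bit_add0 : left_id (bitensor_of [::]) bit_add.
Proof.
by move=> x; apply: bitensor_eq => N b b_bal; rewrite bilift_add // bilift_zero // add0r.
Qed.
Lemma bit_addN : left_inverse (bitensor_of [::]) (bit_scale (-1)) bit_add.
Proof.
move=> x; apply: bitensor_eq => N b b_bal.
by rewrite bilift_add // bilift_opp // bilift_zero // addNr.
Qed.

HB.instance Definition _ :=
  GRing.isZmodule.Build bitensor bit_addA bit_addC bit_add0 bit_addN.

Lemma biliftD (N : zmodType) (beta : 'I_r -> A -> A -> N) x y : balanced beta ->
  bilift beta (x + y) = bilift beta x + bilift beta y.
Proof. exact: bilift_add. Qed.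

Lemma bit_scaleA k l x : bit_scale k (bit_scale l x) = bit_scale (k * l) x.
Proof.
apply: bitensor_eq => N b b_bal; rewrite !bilift_scale //; last exact: balanced_scale.
by apply: eq_bigr => t _; rewrite scalerA mulrC.
Qed.
Lemma bit_scale1 : left_id 1 bit_scale.
Proof.
move=> x; apply: bitensor_eq => N b b_bal; rewrite bilift_scale //.
by apply: eq_bigr => t _; rewrite scale1r.
Qed.
Lemma bit_scaleDr : right_distributive bit_scale +%R.
Proof.
move=> k x y; apply: bitensor_eq => N b b_bal.
by rewrite biliftD // !bilift_scale // biliftD //; apply: balanced_scale.
Qed.
Lemma bit_scaleDl x : {morph bit_scale^~ x : k l / k + l}.
Proof.
move=> k l; apply: bitensor_eq => N b b_bal.
rewrite biliftD // !bilift_scale // /bilift /word_eval -big_split.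
by case: b_bal => D1 _ _; apply: eq_bigr => t _; rewrite scalerDl D1.
Qed.

HB.instance Definition _ :=
  GRing.Zmodule_isLmodule.Build K bitensor bit_scaleA bit_scale1 bit_scaleDr bit_scaleDl.

Definition bigen i a b : bitensor := bitensor_of [:: (i, a, b)].

Lemma bilift_gen (N : zmodType) (beta : 'I_r -> A -> A -> N) i a b : balanced beta ->
  bilift beta (bigen i a b) = beta i a b.
Proof. by move=> beta_bal; rewrite bilift_of // /word_eval big_seq1. Qed.

Lemma bigen_balanced : balanced bigen.
Proof.
split=> [i a a' b|i a b b'|i k a b]; apply: bitensor_eq => N beta beta_bal;
  rewrite ?biliftD // !bilift_gen //; by case: beta_bal.
Qed.

Lemma scale_bigen (k : K) i a b : k *: bigen i a b = bigen i (k *: a) b.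
Proof.
apply: bitensor_eq => N beta beta_bal; rewrite bilift_scale // !bilift_gen //.
exact: balanced_scale.
Qed.

Lemma bitensor_ind (P : bitensor -> Prop) :
  P 0 -> (forall x y, P x -> P y -> P (x + y)) -> (forall i a b, P (bigen i a b)) ->
  forall x, P x.
Proof.
move=> P0 PD Pg x; rewrite -(bitensor_ofK x); elim: (repr x) => // -[[i a] b] s IHs.
suff -> : bitensor_of ((i, a, b) :: s) = bigen i a b + bitensor_of s by apply: PD.
apply: bitensor_eq => N beta beta_bal.
by rewrite biliftD // bilift_gen // !bilift_of // /word_eval big_cons.
Qed.

End BiTensor.

Section AdditiveMaps.

Context (M N : zmodType) (f : M -> N).
Hypothesis fD : {morph f : x y / x + y}.

Lemma morphD0 : f 0 = 0.
Proof. by apply: (@addrI _ (f 0)); rewrite -fD !addr0. Qed.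

Lemma morphDN x : f (- x) = - f x.
Proof. by apply/eqP; rewrite -addr_eq0 -fD addNr morphD0. Qed.

Lemma morphDB x y : f (x - y) = f x - f y.
Proof. by rewrite fD morphDN. Qed.

Lemma morphD_sum I s (P : pred I) F :
  f (\sum_(i <- s | P i) F i) = \sum_(i <- s | P i) f (F i).
Proof. exact: (big_morph f fD morphD0). Qed.

End AdditiveMaps.

Lemma scale_mull (K : fieldType) (A : algType K) (k : K) (a : A) : k *: a = k *: 1 * a.
Proof. by rewrite -scalerAl mul1r. Qed.

Lemma scale_mulr (K : fieldType) (A : algType K) (k : K) (a : A) : k *: a = a * (k *: 1).
Proof. by rewrite -scalerAr mulr1. Qed.

Section FreeBimodule.

Context (K : fieldType) (A : algType K) (r : nat).
Local Notation F := (bitensor A r).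
Local Notation gen := (@bigen K A r).

Lemma bigenDl i a a' b : gen i (a + a') b = gen i a b + gen i a' b.
Proof. by case: (bigen_balanced A r). Qed.

Lemma bigenDr i a b b' : gen i a (b + b') = gen i a b + gen i a b'.
Proof. by case: (bigen_balanced A r). Qed.

Lemma bigenZ i (k : K) a b : gen i (k *: a) b = gen i a (k *: b).
Proof. by case: (bigen_balanced A r). Qed.

Lemma bigen_sumr i I s (P : pred I) (u : I -> A) a :
  gen i a (\sum_(j <- s | P j) u j) = \sum_(j <- s | P j) gen i a (u j).
Proof. by apply: (morphD_sum (f := fun b => gen i a b)) => b b'; apply: bigenDr. Qed.

Lemma bigen0r i a : gen i a 0 = 0.
Proof. by have := morphD0 (bigenDr i a). Qed.

Lemma bigen0l i b : gen i 0 b = 0.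
Proof. by have := morphD0 (fun a a' => bigenDl i a a' b). Qed.

Lemma lact_balanced a : balanced (fun i u v => gen i (a * u) v).
Proof.
split=> [i u u' v|i u v v'|i k u v]; first by rewrite mulrDr bigenDl.
  by rewrite bigenDr.
by rewrite -scalerAr bigenZ.
Qed.

Lemma ract_balanced b : balanced (fun i u v => gen i u (v * b)).
Proof.
split=> [i u u' v|i u v v'|i k u v]; first by rewrite bigenDl.
  by rewrite mulrDl bigenDr.
by rewrite -scalerAl bigenZ.
Qed.

Definition lact (a : A) (x : F) : F := bilift (fun i u v => gen i (a * u) v) x.
Definition ract (x : F) (b : A) : F := bilift (fun i u v => gen i u (v * b)) x.

Lemma lact_gen a i u v : lact a (gen i u v) = gen i (a * u) v.
Proof. exact/bilift_gen/lact_balanced. Qed.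

Lemma ract_gen b i u v : ract (gen i u v) b = gen i u (v * b).
Proof. exact/bilift_gen/ract_balanced. Qed.

Lemma lactDr a : {morph lact a : x y / x + y}.
Proof. by move=> x y; apply/biliftD/lact_balanced. Qed.

Lemma ractDl b : {morph ract^~ b : x y / x + y}.
Proof. by move=> x y; apply/biliftD/ract_balanced. Qed.

Lemma additive_eq (N : zmodType) (f g : F -> N) :
  {morph f : x y / x + y} -> {morph g : x y / x + y} ->
  (forall i a b, f (gen i a b) = g (gen i a b)) -> f =1 g.
Proof.
move=> fD gD fg; apply: bitensor_ind => // [|x y ex ey].
  by rewrite (morphD0 fD) (morphD0 gD).
by rewrite fD gD ex ey.
Qed.

Lemma lactDl a b x : lact (a + b) x = lact a x + lact b x.
Proof.
move: x; apply: additive_eq => [|x y|i u v]; first exact: lactDr.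
  by rewrite !lactDr addrACA.
by rewrite !lact_gen mulrDl bigenDl.
Qed.

Lemma ractDr a b x : ract x (a + b) = ract x a + ract x b.
Proof.
move: x; apply: additive_eq => [|x y|i u v]; first exact: ractDl.
  by rewrite !ractDl addrACA.
by rewrite !ract_gen mulrDr bigenDr.
Qed.

Lemma lact1 x : lact 1 x = x.
Proof. by move: x; apply: additive_eq => [|//|i u v]; rewrite ?lact_gen ?mul1r //; apply: lactDr. Qed.

Lemma ract1 x : ract x 1 = x.
Proof. by move: x; apply: additive_eq => [|//|i u v]; rewrite ?ract_gen ?mulr1 //; apply: ractDl. Qed.

Lemma lactA a b x : lact (a * b) x = lact a (lact b x).
Proof.
move: x; apply: additive_eq => [|x y|i u v]; first exact: lactDr.
  by rewrite !lactDr.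
by rewrite !lact_gen mulrA.
Qed.

Lemma ractA a b x : ract x (a * b) = ract (ract x a) b.
Proof.
move: x; apply: additive_eq => [|x y|i u v]; first exact: ractDl.
  by rewrite !ractDl.
by rewrite !ract_gen mulrA.
Qed.

Lemma lract a b x : ract (lact a x) b = lact a (ract x b).
Proof.
move: x; apply: additive_eq => [x y|x y|i u v]; first by rewrite lactDr ractDl.
  by rewrite ractDl lactDr.
by rewrite ?(lact_gen, ract_gen).
Qed.

Lemma lact_scalar (k : K) x : lact (k *: 1) x = k *: x.
Proof.
move: x; apply: additive_eq => [|x y|i u v]; first exact: lactDr.
  by rewrite scalerDr.
by rewrite lact_gen -scale_mull scale_bigen.
Qed.

Lemma ract_scalar (k : K) x : ract x (k *: 1) = k *: x.
Proof.
move: x; apply: additive_eq => [|x y|i u v]; first exact: ractDl.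
  by rewrite scalerDr.
by rewrite ract_gen -scale_mulr scale_bigen bigenZ.
Qed.

Definition freeB : bimod_data A := @BimodData K A F lact ract.

Lemma freeB_bimod : is_bimod freeB.
Proof.
split.
- split; [exact: lactDr | exact: lactDl | exact: lact1 | exact: lactA].
- split; [exact: ractDl | | exact: ract1 |].
    by move=> a b x; apply: ractDr.
  by move=> a b x; apply: ractA.
- exact: lract.
- by move=> k x; rewrite /= lact_scalar ract_scalar.
Qed.

Section Extension.

Context (N : bimod_data A) (N_bimod : is_bimod N) (nv : 'I_r -> N).

Definition bihom : F -> N := bilift (fun i a b => bm_r (bm_l a (nv i)) b).

Lemma bihom_balanced : balanced (fun i a b => bm_r (bm_l a (nv i)) b).
Proof.
have [[_ lD _ lM] [rDm rD _ rM] lr kN] := N_bimod.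
split=> [i a a' b|i a b b'|i k a b]; [by rewrite lD rDm | by rewrite rD |].
by rewrite scale_mulr lM kN -lr -rM -scale_mull.
Qed.

Lemma bihom_genE i a b : bihom (gen i a b) = bm_r (bm_l a (nv i)) b.
Proof. exact/bilift_gen/bihom_balanced. Qed.

Lemma bihom_gen1 i : bihom (gen i 1 1) = nv i.
Proof. by have [[_ _ l1 _] [_ _ r1 _] _ _] := N_bimod; rewrite bihom_genE l1 r1. Qed.

Lemma bihom_hom : @bimod_hom K A freeB N bihom.
Proof.
have [[lDm lD _ lM] [rDm rD _ rM] lr kN] := N_bimod.
have hD : {morph bihom : x y / x + y} by move=> x y; apply/biliftD/bihom_balanced.
split=> // [a|b]; apply: additive_eq => [x y|x y|i u v] /=;
  rewrite ?(lactDr, ractDl, hD, lDm, rDm) //.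
  by rewrite lact_gen !bihom_genE lM lr.
by rewrite ract_gen !bihom_genE rM.
Qed.

End Extension.

Lemma freeB_free : @free_bimod K A freeB r (fun i => gen i 1 1).
Proof.
split=> [|N N_bimod nv]; first exact: freeB_bimod.
exists (bihom nv); split=> [||g [gD gl gr] ge x].
- exact: bihom_hom.
- exact: bihom_gen1.
have [hD _ _] := bihom_hom N_bimod nv.
apply: additive_eq x => // i a b.
have -> : gen i a b = bm_r (bm_l a (gen i 1 1 : freeB)) b :> freeB.
  by rewrite /= lact_gen ract_gen mulr1 mul1r.
by rewrite gr gl ge /= lact_gen ract_gen mulr1 mul1r bihom_genE.
Qed.

End FreeBimodule.

Section Grading.

Context (K : fieldType) (A : algType K) (G : nat -> A -> Prop).

Definition components (tau : nat -> A -> A) : Prop :=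
  [/\ forall i a, G i (tau i a),
      forall i, {morph tau i : a b / a + b},
      forall i (k : K) a, tau i (k *: a) = k *: tau i a,
      forall i j a, G j a -> tau i a = if i == j then a else 0
    & forall a, exists N, a = \sum_(i < N) tau i a].

Lemma sum_ord_widen (M : zmodType) m n (x : nat -> M) : (m <= n)%N ->
  \sum_(i < m) x i = \sum_(i < n) if (i < m)%N then x i else 0.
Proof. by move=> mn; rewrite (big_ord_widen _ _ mn) big_mkcond. Qed.

Hypothesis grA : graded_algebra G.

Lemma homog0 i : G i 0.
Proof. by case: grA => /(_ i)[]. Qed.

Lemma homogZD i (k : K) a b : G i a -> G i b -> G i (k *: a + b).
Proof. by case: grA => /(_ i)[_ +] _ _ _; apply. Qed.

Lemma homogZ i (k : K) a : G i a -> G i (k *: a).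
Proof. by move=> Ga; rewrite -[k *: a]addr0; apply: homogZD (homog0 i). Qed.

Lemma homogM i j a b : G i a -> G j b -> G (i + j)%N (a * b).
Proof. by case: grA => _ _ _; apply. Qed.

Lemma homog_sum_inj N M x y :
  (forall i, G i (x i)) -> (forall i, G i (y i)) ->
  \sum_(i < N) x i = \sum_(i < M) y i ->
  forall i, (if (i < N)%N then x i else 0) = (if (i < M)%N then y i else 0).
Proof.
move=> Gx Gy.
rewrite (sum_ord_widen x (leq_maxl N M)) (sum_ord_widen y (leq_maxr N M)).
move=> /eqP; rewrite -subr_eq0 -sumrB => /eqP e i.
have [lt_i|ge_i] := ltnP i (maxn N M); last first.
  by move: ge_i; rewrite geq_max => /andP[]; rewrite !ltnNge => -> ->.
case: grA => _ _ inj _.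
pose z j := (if (j < N)%N then x j else 0) - (if (j < M)%N then y j else 0).
apply/eqP; rewrite -subr_eq0; apply/eqP; apply: (inj _ z _ e _ lt_i) => j.
rewrite /z addrC -scaleN1r; apply: homogZD; case: ifP => _ //; exact: homog0.
Qed.

Lemma components_exist : exists tau, components tau.
Proof.
have [_ dec _ _] := grA.
have /choice[N /choice[x Hx]] := dec.
have Gx a i : G i (x a i) by case: (Hx a).
have xE a : a = \sum_(i < N a) x a i by case: (Hx a).
pose tau i a := if (i < N a)%N then x a i else 0.
have Gtau i a : G i (tau i a) by rewrite /tau; case: ifP => _ //; apply: homog0.
have tau_uniq M y a i : (forall i, G i (y i)) -> a = \sum_(i < M) y i ->
    tau i a = if (i < M)%N then y i else 0.
  by move=> Gy aE; apply: homog_sum_inj => //; rewrite -xE.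
have tau_sum a M : (N a <= M)%N -> a = \sum_(i < M) tau i a.
  by move=> le_M; rewrite {1}(xE a) (sum_ord_widen _ le_M).
have tau_lin i (k : K) a b : tau i (k *: a + b) = k *: tau i a + tau i b.
  pose M := maxn i.+1 (maxn (N a) (N b)).
  rewrite (tau_uniq M (fun i => k *: tau i a + tau i b)).
  - by rewrite ifT // /M leq_max ltnSn.
  - by move=> j; apply: homogZD.
  - rewrite big_split -scaler_sumr /= -!tau_sum // /M; last first.
      by rewrite leq_max leq_max leqnn orbT.
    by rewrite leq_max leq_max leqnn !orbT.
have tauD i a b : tau i (a + b) = tau i a + tau i b.
  by have := tau_lin i 1 a b; rewrite !scale1r.
exists tau; split=> // [i k a|i j a Ga|a].
- have := tau_lin i k a 0; rewrite !addr0 => ->.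
  by rewrite (morphD0 (tauD i)) addr0.
- rewrite (tau_uniq j.+1 (fun i => if i == j then a else 0)).
  + by case: eqVneq => [->|]; rewrite ?ltnSn // if_same.
  + by move=> l; case: eqP => [->|] // _; apply: homog0.
  + rewrite (bigD1 ord_max) //= eqxx big1 ?addr0 // => l.
    by rewrite -val_eqE /= => /negPf ->.
- by exists (N a); apply: tau_sum.
Qed.

Lemma homog_ind (P : A -> Prop) : P 0 -> (forall a b, P a -> P b -> P (a + b)) ->
  (forall i a, G i a -> P a) -> forall a, P a.
Proof.
move=> P0 PD PG a; case: grA => _ /(_ a)[N [x [Gx ->]]] _ _.
by elim/big_rec: _ => // i y _; apply/PD/(PG i).
Qed.

Context (tau : nat -> A -> A).
Hypothesis tauP : components tau.

Context (eps : A -> K).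
Hypotheses (connA : connected_grading G) (epsP : standard_augmentation G eps).

Lemma tau0E a : tau 0%N a = eps a *: 1.
Proof.
have [_ tD _ th _] := tauP; have [G1 _ _] := connA.
have [N [x [Gx aE]]] := epsP a; rewrite {1}aE tD (th _ 0%N) ?eqxx; last exact: homogZ.
rewrite (morphD_sum (tD _)) big1 ?addr0 // => i _.
by rewrite (th _ i.+1).
Qed.

Lemma scalar_inj : injective (fun k : K => k *: (1 : A)).
Proof.
have [_ n0 _] := connA; move=> k l /eqP; rewrite -subr_eq0 -scalerBl scaler_eq0.
by rewrite (negPf n0) orbF subr_eq0 => /eqP.
Qed.

Lemma epsD : {morph eps : a b / a + b}.
Proof.
move=> a b; apply: scalar_inj; rewrite -tau0E; have [_ -> _ _ _] := tauP.
by rewrite !tau0E scalerDl.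
Qed.

Lemma epsZ k a : eps (k *: a) = k * eps a.
Proof.
apply: scalar_inj; rewrite -tau0E; have [_ _ -> _ _] := tauP.
by rewrite !tau0E scalerA.
Qed.

Lemma eps1 : eps 1 = 1.
Proof.
apply: scalar_inj; rewrite -tau0E; have [_ _ _ th _] := tauP; have [G1 _ _] := connA.
by rewrite (th _ 0%N) // scale1r.
Qed.

Lemma eps_homog i a : G i.+1 a -> eps a = 0.
Proof.
move=> Ga; apply: scalar_inj; rewrite -tau0E scale0r; have [_ _ _ th _] := tauP.
by rewrite (th _ i.+1).
Qed.

Lemma epsM a b : eps (a * b) = eps a * eps b.
Proof.
have [N [x [Gx {1}->]]] := epsP a.
rewrite mulrDl epsD -scalerAl mul1r epsZ mulr_suml (morphD_sum epsD).
rewrite big1 ?addr0 // => i _; move: b; apply: homog_ind.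
- by rewrite mulr0; have := morphD0 epsD.
- by move=> u v eu ev; rewrite mulrDr epsD eu ev addr0.
- by move=> j u Gu; apply: (@eps_homog (i + j)); rewrite -addSn; apply: homogM.
Qed.

End Grading.

Section HomogeneousComponents.

Context (K : fieldType) (A : algType K) (G : nat -> A -> Prop).
Hypothesis grA : graded_algebra G.
Context (tau : nat -> A -> A).
Hypothesis tauP : components G tau.

Lemma homog_gen_ind r (P : bitensor A r -> Prop) :
  P 0 -> (forall x y, P x -> P y -> P (x + y)) ->
  (forall i j l a b, G j a -> G l b -> P (bigen i a b)) -> forall x, P x.
Proof.
move=> P0 PD Pg; apply: bitensor_ind => // i a b.
move: a; apply: (homog_ind grA) => [|a a' Pa Pa'|j a Ga].
- by rewrite bigen0l.
- by rewrite bigenDl; apply: PD.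
move: b; apply: (homog_ind grA) => [|b b' Pb Pb'|l b Gb].
- by rewrite bigen0r.
- by rewrite bigenDr; apply: PD.
exact: Pg Ga Gb.
Qed.

Lemma additive_eq_homog r (N : zmodType) (f g : bitensor A r -> N) :
  {morph f : x y / x + y} -> {morph g : x y / x + y} ->
  (forall i j l a b, G j a -> G l b -> f (bigen i a b) = g (bigen i a b)) ->
  f =1 g.
Proof.
move=> fD gD fg; apply: homog_gen_ind => // [|x y ex ey].
  by rewrite (morphD0 fD) (morphD0 gD).
by rewrite fD gD ex ey.
Qed.

(* [D i] is the degree assigned to the [i]-th generator. *)
Definition gen_comp r (D : 'I_r -> nat) m i a b : bitensor A r :=
  \sum_(j < m.+1) \sum_(l < m.+1 | (j + D i + l == m)%N) bigen i (tau j a) (tau l b).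

Lemma gen_comp_balanced r (D : 'I_r -> nat) m : balanced (gen_comp D m).
Proof.
have [_ tD tZ _ _] := tauP; rewrite /gen_comp; split=> [i a a' b|i a b b'|i k a b].
- rewrite -big_split; apply: eq_bigr => j _; rewrite -big_split.
  by apply: eq_bigr => l _; rewrite tD bigenDl.
- rewrite -big_split; apply: eq_bigr => j _; rewrite -big_split.
  by apply: eq_bigr => l _; rewrite tD bigenDr.
- apply: eq_bigr => j _; apply: eq_bigr => l _.
  by rewrite !tZ bigenZ.
Qed.

Definition bcomp r (D : 'I_r -> nat) m : bitensor A r -> bitensor A r :=
  bilift (gen_comp D m).

Section Bcomp.

Context (r : nat) (D : 'I_r -> nat).

Lemma bcompD m : {morph bcomp D m : x y / x + y}.
Proof. by move=> x y; apply/biliftD/gen_comp_balanced. Qed.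

Lemma bcomp_homog m i a b j l : G j a -> G l b ->
  bcomp D m (bigen i a b) = if (j + D i + l == m)%N then bigen i a b else 0.
Proof.
move=> Ga Gb; have [_ _ _ th _] := tauP.
rewrite /bcomp bilift_gen; last exact: gen_comp_balanced.
rewrite /gen_comp; case: eqVneq => [e|ne]; last first.
  rewrite big1 // => j' _; rewrite big1 // => l' e'.
  rewrite (th _ _ _ Ga) (th _ _ _ Gb).
  case: eqP => [ej|_]; last by rewrite bigen0l.
  case: eqP => [el|_]; last by rewrite bigen0r.
  by rewrite -ej -el e' in ne.
have lt_j : (j < m.+1)%N by rewrite ltnS -e -addnA leq_addr.
have lt_l : (l < m.+1)%N by rewrite ltnS -e leq_addl.
rewrite (bigD1 (Ordinal lt_j)) //= (bigD1 (Ordinal lt_l)) /= ?e //.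
rewrite (th _ _ _ Ga) (th _ _ _ Gb) !eqxx.
rewrite big1 ?big1 ?addr0 // => [j' /negPf nj|l' /andP[_ /negPf nl]].
  rewrite big1 // => l' _; rewrite (th _ _ _ Ga).
  by move: nj; rewrite -val_eqE /= => ->; rewrite bigen0l.
rewrite (th _ _ _ Gb).
by move: nl; rewrite -val_eqE /= => ->; rewrite bigen0r.
Qed.

Lemma bcomp_lact m j a x : G j a ->
  bcomp D m (lact a x) = if (j <= m)%N then lact a (bcomp D (m - j) x) else 0.
Proof.
move=> Ga; move: x; apply: additive_eq_homog => [x y|x y|i j' l u v Gu Gv].
- by rewrite lactDr bcompD.
- by case: ifP => _; rewrite ?addr0 // bcompD lactDr.
rewrite lact_gen (bcomp_homog _ _ (homogM grA Ga Gu) Gv) (bcomp_homog _ _ Gu Gv).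
rewrite -!addnA; case: leqP => [le_j|lt_m].
  rewrite -{1}(subnKC le_j) eqn_add2l; case: ifP => _; first by rewrite lact_gen.
  by rewrite (morphD0 (lactDr _)).
by rewrite ifF //; apply/eqP => e; move: lt_m; rewrite -e ltnNge leq_addr.
Qed.

Lemma bcomp_ract m l b x : G l b ->
  bcomp D m (ract x b) = if (l <= m)%N then ract (bcomp D (m - l) x) b else 0.
Proof.
move=> Gb; move: x; apply: additive_eq_homog => [x y|x y|i j l' u v Gu Gv].
- by rewrite ractDl bcompD.
- by case: ifP => _; rewrite ?addr0 // bcompD ractDl.
rewrite ract_gen (bcomp_homog _ _ Gu (homogM grA Gv Gb)) (bcomp_homog _ _ Gu Gv).
rewrite addnA; case: leqP => [le_l|lt_m].
  rewrite -{1}(subnK le_l) eqn_add2r; case: ifP => _; first by rewrite ract_gen.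
  by rewrite (morphD0 (ractDl _)).
by rewrite ifF //; apply/eqP => e; move: lt_m; rewrite -e ltnNge leq_addl.
Qed.

Lemma bcomp_idem m l x : bcomp D m (bcomp D l x) = if m == l then bcomp D l x else 0.
Proof.
move: x; apply: additive_eq_homog => [x y|x y|i j j' u v Gu Gv].
- by rewrite !bcompD.
- by case: ifP => _; rewrite ?addr0 // bcompD.
rewrite (bcomp_homog _ _ Gu Gv); case: (eqVneq (j + D i + j')%N l) => [<-|_].
  by rewrite (bcomp_homog _ _ Gu Gv) eq_sym.
by rewrite if_same (morphD0 (bcompD _)).
Qed.

Lemma bcomp_sum x : exists N, forall M, (N <= M)%N -> x = \sum_(m < M) bcomp D m x.
Proof.
move: x; apply: homog_gen_ind => [|x y [N xN] [N' yN]|i j l a b Ga Gb].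
- by exists 0%N => M _; rewrite big1 // => m _; rewrite (morphD0 (bcompD _)).
- exists (maxn N N') => M; rewrite geq_max => /andP[/xN {1}-> /yN {1}->].
  by rewrite -big_split; apply: eq_bigr => m _; rewrite bcompD.
- exists (j + D i + l).+1 => M lt_M; rewrite (bigD1 (Ordinal lt_M)) //=.
  rewrite (bcomp_homog _ _ Ga Gb) eqxx big1 ?addr0 // => m.
  by rewrite -val_eqE /= eq_sym (bcomp_homog _ _ Ga Gb) => /negPf ->.
Qed.

End Bcomp.

Definition homog_elt r (D : 'I_r -> nat) m (x : bitensor A r) : Prop :=
  forall l, bcomp D l x = if l == m then x else 0.

Lemma bcomp_hom r s (D : 'I_r -> nat) (D' : 'I_s -> nat) (z : 'I_s -> freeB A r) :
  (forall i, homog_elt D (D' i) (z i)) ->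
  forall m x, bihom z (bcomp D' m x) = bcomp D m (bihom z x).
Proof.
move=> zh m; have [hD _ _] := bihom_hom (freeB_bimod A r) z.
apply: additive_eq_homog => [x y|x y|i j l u v Gu Gv].
- by rewrite bcompD hD.
- by rewrite hD bcompD.
rewrite (bcomp_homog _ _ _ Gu Gv) bihom_genE; last exact: freeB_bimod.
rewrite /= (bcomp_ract _ _ _ Gv) (bcomp_lact _ _ _ Gu) zh.
case: eqVneq => [<-|ne].
  rewrite leq_addl addnK leq_addr addKn eqxx bihom_genE //; exact: freeB_bimod.
have [le_l|//] := leqP l m.
  have [le_j|_] := leqP j (m - l).
    rewrite ifF ?(morphD0 (lactDr _)) ?(morphD0 (ractDl _)) ?(morphD0 hD) //.
    apply/eqP => e; case/eqP: ne.
    by rewrite -e subnKC // subnK.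
  by rewrite (morphD0 (ractDl _)) (morphD0 hD).
by rewrite (morphD0 hD).
Qed.

End HomogeneousComponents.

Section RightReduction.

Context (K : fieldType) (A : algType K) (G : nat -> A -> Prop) (eps : A -> K).
Hypotheses (grA : graded_algebra G) (connA : connected_grading G)
  (epsP : standard_augmentation G eps).

Lemma eps_augmentation :
  [/\ {morph eps : a b / a + b}, forall k a, eps (k *: a) = k * eps a, eps 1 = 1,
      forall a b, eps (a * b) = eps a * eps b
    & forall i a, G i.+1 a -> eps a = 0].
Proof.
have [tau tauP] := components_exist grA; split.
- exact: (epsD grA tauP connA epsP).
- exact: (epsZ grA tauP connA epsP).
- exact: (eps1 grA tauP connA epsP).
- exact: (epsM grA tauP connA epsP).
- exact: (eps_homog grA tauP connA epsP).
Qed.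

Context (r : nat).

(* The reduction modulo the right action of the augmentation ideal, whose target
   is the free left module of rank [r]. *)
Definition bar : bitensor A r -> 'rV[A]_r :=
  bilift (fun i a b => (eps b *: a) *: delta_mx 0 i).

Lemma bar_balanced :
  balanced (fun (i : 'I_r) a b => (eps b *: a) *: delta_mx 0 i : 'rV[A]_r).
Proof.
have [eD eZ _ _ _] := eps_augmentation.
split=> [i a a' b|i a b b'|i k a b]; first by rewrite scalerDr scalerDl.
  by rewrite eD !scalerDl.
by rewrite eZ scalerA mulrC.
Qed.

Lemma bar_gen i a b : bar (bigen i a b) = (eps b *: a) *: delta_mx 0 i.
Proof. exact/bilift_gen/bar_balanced. Qed.

Lemma barD : {morph bar : x y / x + y}.
Proof. by move=> x y; apply/biliftD/bar_balanced. Qed.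

Lemma bar_lact a x : bar (lact a x) = a *: bar x.
Proof.
move: x; apply: additive_eq => [x y|x y|i u v]; first by rewrite lactDr barD.
  by rewrite barD scalerDr.
by rewrite lact_gen !bar_gen scalerA scalerAr.
Qed.

Lemma bar_ract b x : bar (ract x b) = (eps b *: 1) *: bar x.
Proof.
have [_ _ _ eM _] := eps_augmentation.
move: x; apply: additive_eq => [x y|x y|i u v]; first by rewrite ractDl barD.
  by rewrite barD scalerDr.
by rewrite ract_gen !bar_gen scalerA -scalerAl mul1r scalerA eM mulrC.
Qed.

Definition unbar (v : 'rV[A]_r) : bitensor A r := \sum_i bigen i (v 0 i) 1.

Lemma unbarD : {morph unbar : u v / u + v}.
Proof.
move=> u v; rewrite /unbar -big_split; apply: eq_bigr => i _.
by rewrite mxE bigenDl.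
Qed.

Lemma unbarK : cancel unbar bar.
Proof.
have [_ _ e1 _ _] := eps_augmentation.
move=> v; rewrite /unbar (morphD_sum barD) [RHS]row_sum_delta.
by apply: eq_bigr => i _; rewrite bar_gen e1 scale1r.
Qed.

Lemma bar_ker_ind (P : bitensor A r -> Prop) :
  P 0 -> (forall x y, P x -> P y -> P (x + y)) ->
  (forall i c x, G i.+1 c -> P (ract x c)) -> forall x, bar x = 0 -> P x.
Proof.
move=> P0 PD Pc; suff Pb x : P (x - unbar (bar x)).
  by move=> x x0; have := Pb x; rewrite x0 (morphD0 unbarD) subr0.
move: x; apply: bitensor_ind => [|x y Px Py|i a b].
- by rewrite (morphD0 barD) (morphD0 unbarD) subr0.
- by rewrite barD unbarD opprD addrACA; apply: PD.
have -> : unbar (bar (bigen i a b)) = bigen i a (eps b *: 1).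
  rewrite /unbar bar_gen (bigD1 i) //= big1 ?addr0 => [|j ji].
    by rewrite !mxE !eqxx mulr1 bigenZ.
  by rewrite !mxE (negPf ji) andbF mulr0 bigen0l.
have [N [x [Gx {1}->]]] := epsP b.
rewrite bigenDr addrC addKr bigen_sumr; elim/big_rec: _ => // j y _; apply: PD.
have -> : bigen i a (x j) = ract (bigen i a 1) (x j) by rewrite ract_gen mul1r.
exact: Pc (Gx j).
Qed.

End RightReduction.

Section RightLift.

Context (K : fieldType) (A : algType K) (r s : nat).

Lemma right_linear_scale t (pi : bitensor A r -> bitensor A t) :
  (forall x b, pi (ract x b) = ract (pi x) b) -> forall (k : K) x, pi (k *: x) = k *: pi x.
Proof. by move=> piR k x; rewrite -!ract_scalar piR. Qed.

Lemma right_lift t (pi : bitensor A r -> bitensor A t) (d : bitensor A s -> bitensor A t) :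
  {morph pi : x y / x + y} -> (forall x b, pi (ract x b) = ract (pi x) b) ->
  {morph d : x y / x + y} -> (forall x b, d (ract x b) = ract (d x) b) ->
  (forall x, exists y, d y = pi x) ->
  exists sigma : bitensor A r -> bitensor A s,
  [/\ {morph sigma : x y / x + y}, forall x b, sigma (ract x b) = ract (sigma x) b
    & forall x, d (sigma x) = pi x].
Proof.
move=> piD piR dD dR d_onto.
have dZ (k : K) x : d (k *: x) = k *: d x by rewrite -!ract_scalar dR.
have lift i : exists phi : A -> bitensor A s,
    (forall (k : K) a b, phi (k *: a + b) = k *: phi a + phi b) /\
    forall a, d (phi a) = pi (bigen i a 1).
  apply: linear_lift => [k x y|k a b|a]; first by rewrite dD dZ.
    by rewrite bigenDl piD -scale_bigen right_linear_scale.
  exact: d_onto.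
have [phi phiP] := choice lift.
have phiL i : forall (k : K) a b, phi i (k *: a + b) = k *: phi i a + phi i b.
  by case: (phiP i).
have phiD i : {morph phi i : a b / a + b}.
  by move=> a b; have := phiL i 1 a b; rewrite !scale1r.
have phiZ i (k : K) a : phi i (k *: a) = k *: phi i a.
  by have := phiL i k a 0; rewrite !addr0 (morphD0 (phiD i)) addr0.
have bal : balanced (fun i a b => ract (phi i a) b).
  split=> [i a a' b|i a b b'|i k a b]; first by rewrite phiD ractDl.
    by rewrite ractDr.
  by rewrite phiZ -ract_scalar -ractA -scale_mull.
have sD : {morph bilift (fun i a b => ract (phi i a) b) : x y / x + y}.
  by move=> x y; apply: biliftD.
exists (bilift (fun i a b => ract (phi i a) b)); split=> // [x b|x].
  move: x; apply: additive_eq => [x y|x y|i u v]; first by rewrite ractDl sD.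
    by rewrite sD ractDl.
  by rewrite ract_gen !bilift_gen // ractA.
move: x; apply: additive_eq => [x y|//|i u v]; first by rewrite sD dD.
rewrite bilift_gen // dR; case: (phiP i) => _ ->.
by rewrite -piR ract_gen mul1r.
Qed.

End RightLift.

Section SyzygyStep.

Context (K : fieldType) (A : algType K) (G : nat -> A -> Prop) (eps : A -> K).
Hypotheses (grA : graded_algebra G) (connA : connected_grading G)
  (epsP : standard_augmentation G eps).
Context (tau : nat -> A -> A).
Hypothesis tauP : components G tau.

Definition split_graded r (D : 'I_r -> nat) (Z : bitensor A r -> Prop) : Prop :=
  [/\ forall x y, Z x -> Z y -> Z (x + y),
      forall a x, Z x -> Z (lact a x),
      forall b x, Z x -> Z (ract x b),
      forall m x, Z x -> Z (bcomp tau D m x)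
    & exists pi : bitensor A r -> bitensor A r,
      [/\ {morph pi : x y / x + y}, forall x b, pi (ract x b) = ract (pi x) b,
          forall x, Z (pi x) & forall x, Z x -> pi x = x]].

Definition bar_image r (Z : bitensor A r -> Prop) (v : 'rV[A]_r) : Prop :=
  exists2 x, Z x & v = bar eps x.

Section Kernel.

Context (r s : nat) (z : 'I_s -> freeB A r).
Local Notation d := (bihom z : bitensor A s -> bitensor A r).

Lemma freeB_homD : {morph d : x y / x + y}.
Proof. by case: (bihom_hom (freeB_bimod A r) z). Qed.

Lemma freeB_hom_lact a x : d (lact a x) = lact a (d x).
Proof. by case: (bihom_hom (freeB_bimod A r) z) => _ + _; apply. Qed.

Lemma freeB_hom_ract x b : d (ract x b) = ract (d x) b.
Proof. by case: (bihom_hom (freeB_bimod A r) z) => _ _; apply. Qed.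

Definition bar_mx : 'M[A]_(s, r) := \matrix_i bar eps (z i).

Lemma bar_hom x : bar eps (d x) = bar eps x *m bar_mx.
Proof.
have bD := barD grA connA epsP.
move: x; apply: additive_eq => [x y|x y|i u v]; first by rewrite freeB_homD bD.
  by rewrite bD mulmxDl.
rewrite bihom_genE; last exact: freeB_bimod.
rewrite (bar_ract grA connA epsP) (bar_lact grA connA epsP) (bar_gen grA connA epsP).
rewrite -scalemxAl -rowE rowK scalerA -scalerAl mul1r //.
Qed.

(* The kernel of a map onto a split submodule is split by [1 - sigma d], with
   [sigma] a right linear section. *)
Lemma kernel_split_graded (D : 'I_r -> nat) (D' : 'I_s -> nat) (Z : bitensor A r -> Prop) :
  split_graded D Z -> (forall i, homog_elt tau D (D' i) (z i)) ->
  (forall x, Z x <-> exists y, x = d y) ->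
  split_graded D' (fun y => d y = 0) /\
  forall w, bar_image (fun y => d y = 0) w <-> w *m bar_mx = 0.
Proof.
move=> [_ _ _ _ [pi [piD piR piZ pi_id]]] zh Zd.
have dD := freeB_homD; have dR := freeB_hom_ract; have dL := freeB_hom_lact.
have bD := barD grA connA epsP.
have [|sigma [sD sR ds]] := right_lift piD piR dD dR.
  by move=> x; have [y ->] := (Zd _).1 (piZ x); exists y.
have pi'Z y : d (y - sigma (d y)) = 0.
  by rewrite (morphDB dD) ds pi_id ?subrr //; apply/Zd; exists y.
split; first split.
- by move=> x y x0 y0; rewrite dD x0 y0 addr0.
- by move=> a x x0; rewrite dL x0 (morphD0 (lactDr a)).
- by move=> b x x0; rewrite dR x0 (morphD0 (ractDl b)).
- move=> m x x0; rewrite (bcomp_hom grA tauP zh) x0.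
  exact: (morphD0 (bcompD tauP _ _)).
- exists (fun y => y - sigma (d y)); split=> // [x y|x b|x x0].
  + by rewrite dD sD opprD addrACA.
  + by rewrite dR sR -(morphDB (ractDl b)).
  + by rewrite x0 (morphD0 sD) subr0.
move=> w; split=> [[x x0 ->]|w0]; first by rewrite -bar_hom x0 (morphD0 (bD _)).
exists (unbar w - sigma (d (unbar w))) => //.
rewrite (morphDB (bD _)) (unbarK grA connA epsP).
suff -> : bar eps (sigma (d (unbar w))) = 0 by rewrite subr0.
apply: (bar_ker_ind grA connA epsP (P := fun x => bar eps (sigma x) = 0)).
- by rewrite (morphD0 sD) (morphD0 (bD _)).
- by move=> x y x0 y0; rewrite sD bD x0 y0 addr0.
- move=> i c x Gc; rewrite sR (bar_ract grA connA epsP).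
  have [_ _ _ _ e0] := eps_augmentation grA connA epsP.
  by rewrite (e0 _ _ Gc) !scale0r.
- by rewrite bar_hom (unbarK grA connA epsP).
Qed.

End Kernel.

(* Graded Nakayama: only the right augmentation ideal has to be divided out. *)
Lemma graded_nakayama r s (D : 'I_r -> nat) (D' : 'I_s -> nat)
    (Z : bitensor A r -> Prop) (z : 'I_s -> freeB A r) :
  split_graded D Z -> (forall i, homog_elt tau D (D' i) (z i)) ->
  (forall i, Z (z i)) ->
  (forall x, Z x -> exists y, bar eps x = bar eps (bihom z y)) ->
  forall x, Z x <-> exists y, x = bihom z y.
Proof.
move=> [ZD ZL ZR ZC [pi [piD piR piZ pi_id]]] zh Zz zgen.
have dD := freeB_homD z; have dR := freeB_hom_ract z; have dL := freeB_hom_lact z.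
have bD := barD grA connA epsP; have cD := bcompD tauP.
have Z0 : Z 0 by rewrite -(morphD0 piD).
have Zd y : Z (bihom z y).
  move: y; apply: bitensor_ind => [|x y Zx Zy|i a b]; first by rewrite (morphD0 dD).
    by rewrite dD; apply: ZD.
  by rewrite bihom_genE; [apply/ZR/ZL | exact: freeB_bimod].
have ZB x y : Z x -> Z y -> Z (x - y).
  by move=> Zx Zy; apply: ZD => //; rewrite -scaleN1r -ract_scalar; apply: ZR.
move=> x; split=> [Zx|[y ->] //].
pose W y := exists y', y = bihom z y'.
have W0 : W 0 by exists 0; rewrite (morphD0 dD).
have WD u v : W u -> W v -> W (u + v).
  by move=> [u' ->] [v' ->]; exists (u' + v'); rewrite dD.
suff Wc m : forall x, Z x -> W (bcomp tau D m x).
  have [N /(_ _ (leqnn _)) ->] := bcomp_sum grA tauP D x.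
  by elim/big_rec: _ => [|m y _ Wy]; [exact: W0 | apply: WD => //; apply: Wc].
elim/ltn_ind: m => m IHm {Zx}x Zx.
have [y xy] := zgen x Zx.
rewrite -(subrK (bihom z y) x) cD; apply: (WD); last first.
  by exists (bcomp tau D' m y); rewrite (bcomp_hom grA tauP zh).
rewrite -(pi_id (x - _)); last exact: ZB.
apply: (bar_ker_ind grA connA epsP (P := fun x => W (bcomp tau D m (pi x)))).
- by rewrite (morphD0 piD) (morphD0 (cD _ _ _)).
- by move=> u v Wu Wv; rewrite piD cD; apply: WD.
- move=> i c u Gc; rewrite piR (bcomp_ract grA tauP _ _ _ Gc).
  case: leqP => // lt_i; have [|v ->] := IHm (m - i.+1)%N _ (pi u) (piZ u).
    by rewrite ltn_subrL /= (leq_trans _ lt_i).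
  by exists (ract v c); rewrite dR.
- by rewrite (morphDB (bD _)) xy subrr.
Qed.

Lemma syzygy_step r (D : 'I_r -> nat) (Z : bitensor A r -> Prop) q (N : 'M[A]_(q, r)) :
  split_graded D Z -> (forall j, bar_image Z (row j N)) ->
  (forall v, bar_image Z v -> exists w, v = w *m N) ->
  exists s (D' : 'I_s -> nat) (z : 'I_s -> freeB A r) (M : 'M[A]_(s, r)),
  [/\ forall x, Z x <-> exists y, x = bihom z y,
      split_graded D' (fun y => bihom z y = 0),
      forall v, bar_image Z v <-> exists w, v = w *m M
    & forall w, bar_image (fun y => bihom z y = 0) w <-> w *m M = 0].
Proof.
move=> Zsp Nim Ngen; have [ZD ZL ZR ZC _] := Zsp.
have bD := barD grA connA epsP.
have /choice[x xP] : forall j, exists x, Z x /\ row j N = bar eps x.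
  by move=> j; case: (Nim j) => x Zx xE; exists x.
have /choice[n nP] := fun j => bcomp_sum grA tauP D (x j).
pose L := \max_j n j.
pose T := ('I_q * 'I_L)%type.
pose z (t : 'I_#|{: T}|) : freeB A r :=
  bcomp tau D (enum_val t).2 (x (enum_val t).1).
pose D' (t : 'I_#|{: T}|) : nat := (enum_val t).2.
have zh i : homog_elt tau D (D' i) (z i) by move=> l; apply: (bcomp_idem grA tauP).
have Zz i : Z (z i) by apply: ZC; case: (xP (enum_val i).1).
have dD := freeB_homD z; have dL := freeB_hom_lact z.
have x_im j : exists y, x j = bihom z y.
  exists (\sum_(m < L) bigen (enum_rank ((j, m) : T)) 1 1).
  rewrite (morphD_sum dD) [LHS](nP j L (leq_bigmax j)); apply: eq_bigr => m _.
  by rewrite bihom_gen1 /z ?enum_rankK //; apply: freeB_bimod.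
have /choice[y yP] := x_im.
have Zim : forall x, Z x <-> exists y, x = bihom z y.
  apply: (graded_nakayama Zsp zh Zz) => u Zu.
  have [|w wE] := Ngen (bar eps u); first by exists u.
  exists (\sum_j lact (w 0 j) (y j)).
  rewrite wE mulmx_sum_row (morphD_sum dD) (morphD_sum (bD _)).
  apply: eq_bigr => j _; rewrite dL (bar_lact grA connA epsP) -yP.
  by case: (xP j) => _ ->.
have [Ksp Kbar] := kernel_split_graded Zsp zh Zim.
exists #|{: T}|, D', z, (bar_mx z); split=> // v; split.
  by case=> u /Zim[w ->] ->; exists (bar eps w); apply: bar_hom.
case=> w ->; exists (bihom z (unbar w)); first by apply/Zim; exists (unbar w).
by rewrite bar_hom (unbarK grA connA epsP).
Qed.

End SyzygyStep.

Section Comparison.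

Context (R : nzRingType).

(* Chain homotopy data between two partial resolutions of one module, cut off
   at the current kernels [ZP] and [ZQ]: [f] and [g] are the top components of
   chain maps, and [H] is [1 - g f] corrected by the last homotopy. *)
Definition comparable p q (ZP : 'rV[R]_p -> Prop) (ZQ : 'rV[R]_q -> Prop) : Prop :=
  exists (f : 'M[R]_(p, q)) (g : 'M[R]_(q, p)) (H : 'M[R]_q),
  [/\ forall u, ZP u -> ZQ (u *m f),
      forall v, ZQ v -> ZP (v *m g),
      forall v, ZQ (v *m H)
    & forall v, ZQ v -> v = v *m g *m f + v *m H].

Lemma rows_factor p q s (M : 'M[R]_(q, s)) (N : 'M[R]_(p, s)) :
  (forall u : 'rV_p, exists w, u *m N = w *m M) -> exists X, N = X *m M.
Proof.
move=> NM; have /choice[x xP] := fun i : 'I_p => NM (delta_mx 0 i).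
exists (\matrix_i x i); apply/row_matrixP => i.
by rewrite row_mul rowK -xP rowE.
Qed.

Lemma comparable_fg p q s (ZP : 'rV[R]_p -> Prop) (ZQ : 'rV[R]_q -> Prop)
    (d : 'M[R]_(s, p)) :
  (forall u v, ZQ u -> ZQ v -> ZQ (u + v)) ->
  comparable ZP ZQ -> (forall u, ZP u <-> exists w, u = w *m d) ->
  exists t (N : 'M[R]_(t, q)),
    (forall j, ZQ (row j N)) /\ forall v, ZQ v -> exists w, v = w *m N.
Proof.
move=> ZQD [f [g [H [fZ gZ HZ gfH]]]] dP.
exists (s + q)%N, (col_mx (d *m f) H); split=> [j|v Zv].
  have [k ->|k ->] := split_ordP j.
    rewrite rowKu rowE mulmxA; apply/fZ/dP.
    by exists (delta_mx 0 k).
  by rewrite rowKd rowE.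
have [w wE] := (dP _).1 (gZ v Zv).
by exists (row_mx w v); rewrite mul_row_col mulmxA -wE -gfH.
Qed.

Lemma comparable_step p q p' q' (ZP : 'rV[R]_p -> Prop) (ZQ : 'rV[R]_q -> Prop)
    (d : 'M[R]_(p', p)) (M : 'M[R]_(q', q)) :
  comparable ZP ZQ -> (forall u, ZP u <-> exists w, u = w *m d) ->
  (forall v, ZQ v <-> exists w, v = w *m M) ->
  comparable (fun u => u *m d = 0) (fun v => v *m M = 0).
Proof.
move=> [f [g [H [fZ gZ HZ gfH]]]] dP MP.
have [f' f'E] : exists X, d *m f = X *m M.
  by apply: rows_factor => u; apply/MP; rewrite mulmxA; apply/fZ/dP; exists u.
have [g' g'E] : exists X, M *m g = X *m d.
  by apply: rows_factor => u; apply/dP; rewrite mulmxA; apply/gZ/MP; exists u.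
have [S SE] : exists X, H = X *m M by apply: rows_factor => u; apply/MP.
have ME : M = g' *m f' *m M + M *m S *m M.
  transitivity (M *m g *m f + M *m H); last first.
    by rewrite g'E SE -!mulmxA -f'E.
  apply/row_matrixP => i; rewrite raddfD /= !row_mul; apply: gfH.
  by apply/MP; exists (delta_mx 0 i); rewrite rowE.
exists f', g', (1%:M - g' *m f' - M *m S); split=> [u u0|v v0|v|v v0].
- by rewrite -mulmxA -f'E mulmxA u0 mul0mx.
- by rewrite -mulmxA -g'E mulmxA v0 mul0mx.
- rewrite -mulmxA !mulmxBl mul1mx {1}ME -!mulmxA.
  by rewrite addrAC addrK subrr mulmx0.
- by rewrite !mulmxBr mulmx1 !mulmxA v0 mul0mx subr0 addrC subrK.
Qed.

End Comparison.

Lemma regular_is_bimod (K : fieldType) (A : algType K) : is_bimod (regular_bimod A).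
Proof.
split=> /=; last by move=> k m; rewrite -scale_mull scale_mulr.
- by split=> *; rewrite ?mulrDr ?mulrDl ?mul1r ?mulrA.
- by split=> *; rewrite ?mulrDr ?mulrDl ?mulr1 ?mulrA.
- by move=> a b m; rewrite mulrA.
Qed.

Section BimoduleResolution.

Context (K : fieldType) (A : algType K) (G : nat -> A -> Prop) (eps : A -> K).
Hypotheses (grA : graded_algebra G) (connA : connected_grading G)
  (epsP : standard_augmentation G eps).
Context (tau : nat -> A -> A).
Hypothesis tauP : components G tau.

Definition bimul : freeB A 1 -> regular_bimod A :=
  bihom (fun=> 1 : regular_bimod A).

Lemma bimul_hom : bimod_hom bimul.
Proof. exact/bihom_hom/regular_is_bimod. Qed.

Lemma bimul_gen i a b : bimul (bigen i a b) = a * b.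
Proof. by rewrite /bimul bihom_genE /= ?mulr1 //; apply: regular_is_bimod. Qed.

Lemma bimul_bcomp m x : bimul (bcomp tau (fun=> 0%N) m x) = tau m (bimul x).
Proof.
have [pD _ _] := bimul_hom; have [_ tD _ th _] := tauP.
move: x; apply: (additive_eq_homog grA) => [x y|x y|i j l a b Ga Gb].
- by rewrite (bcompD tauP) pD.
- by rewrite pD tD.
rewrite (bcomp_homog tauP _ _ _ Ga Gb) addn0 bimul_gen (th _ _ _ (homogM grA Ga Gb)).
by rewrite eq_sym; case: ifP => _; [rewrite bimul_gen | rewrite (morphD0 pD)].
Qed.

Lemma bimul_ker_split : split_graded tau (fun=> 0%N) (fun x => bimul x = 0).
Proof.
have [pD pL pR] := bimul_hom; have [_ tD _ _ _] := tauP; split.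
- by move=> x y x0 y0; rewrite pD x0 y0 addr0.
- by move=> a x x0; rewrite (pL a x) x0 /= mulr0.
- by move=> b x x0; rewrite (pR b x) x0 /= mul0r.
- by move=> m x x0; rewrite bimul_bcomp x0 (morphD0 (tD m)).
exists (fun x => x - bigen 0 1 (bimul x)); split=> [x y|x b|x|x x0].
- by rewrite pD bigenDr opprD addrACA.
- by rewrite (pR b x) (morphDB (ractDl b)) ract_gen.
- by rewrite (morphDB pD) bimul_gen mul1r subrr.
- by rewrite x0 bigen0r subr0.
Qed.

Lemma bar_bimul_ker v : bar_image eps (fun x => bimul x = 0) v <-> eps (v 0 0) = 0.
Proof.
have [pD pL pR] := bimul_hom; have bD := barD grA connA epsP.
have [eD eZ e1 eM _] := eps_augmentation grA connA epsP.
have eps_bar x : eps (bar eps x 0 0) = eps (bimul x).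
  move: x; apply: additive_eq => [x y|x y|i a b]; first by rewrite bD mxE eD.
    by rewrite pD eD.
  by rewrite (bar_gen grA connA epsP) bimul_gen !mxE ord1 eqxx mulr1 eZ eM mulrC.
split=> [[x x0 ->]|v0]; first by rewrite eps_bar x0 (morphD0 eD).
exists (unbar v - bigen 0 1 (v 0 0)).
  rewrite (morphDB pD) bimul_gen mul1r /unbar (morphD_sum pD) big_ord1.
  by rewrite bimul_gen mulr1 subrr.
rewrite (morphDB (bD _)) (unbarK grA connA epsP) (bar_gen grA connA epsP) v0.
by rewrite !scale0r subr0.
Qed.

Lemma comparable_augmentation r (p : 'rV[A]_r -> K) :
  (forall u v, p (u + v) = p u + p v) -> (forall a v, p (a *: v) = eps a * p v) ->
  (forall k, exists v, p v = k) ->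
  comparable (fun u => p u = 0) (fun v : 'rV[A]_1 => eps (v 0 0) = 0).
Proof.
move=> pD pZ p_onto; have [v0 pv0] := p_onto 1.
have [eD eZ e1 eM _] := eps_augmentation grA connA epsP.
pose f : 'M[A]_(r, 1) := \col_i (p (delta_mx 0 i) *: 1).
have eps_f u : eps ((u *m f) 0 0) = p u.
  rewrite {2}(row_sum_delta u) (morphD_sum pD) mxE (morphD_sum eD).
  by apply: eq_bigr => i _; rewrite !mxE eM eZ e1 mulr1 pZ.
have scal (v : 'rV[A]_1) : v *m v0 = v 0 0 *: v0.
  by apply/rowP => i; rewrite !mxE big_ord1.
exists f, v0, (1%:M - v0 *m f); split=> [u u0|v e0|v|v _].
- by rewrite eps_f.
- by rewrite scal pZ e0 mul0r.
- have -> : (v *m (1%:M - v0 *m f)) 0 0 = v 0 0 - (v *m v0 *m f) 0 0.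
    by rewrite mulmxBr mulmx1 mulmxA !mxE.
  by rewrite (morphDB eD) eps_f scal pZ pv0 mulr1 subrr.
- by rewrite mulmxBr mulmx1 mulmxA addrC subrK.
Qed.

Record stage := Stage {
  st_rank : nat;
  st_deg : 'I_st_rank -> nat;
  st_syz : bitensor A st_rank -> Prop }.

Definition linked (s s' : stage) (z : 'I_(st_rank s') -> freeB A (st_rank s)) : Prop :=
  (forall x, @st_syz s x <-> exists y, x = bihom z y) /\
  (forall y, @st_syz s' y <-> bihom z y = 0).

Lemma left_FPn_bi_FPn n : left_FPn eps n -> bi_FPn A n.
Proof.
move=> [rP [p [d [pD pZ p_onto exact0 exactS]]]].
pose ZP k : 'rV[A]_(rP k) -> Prop :=
  match k with 0%N => fun v => p v = 0 | k'.+1 => fun v => v *m d k' = 0 end.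
have ZP_im k : (k < n)%N -> forall u, ZP k u <-> exists w, u = w *m d k.
  by case: k => [|k] lt_k u; [apply: exact0 | apply: exactS].
pose Inv k s := split_graded tau (@st_deg s) (@st_syz s) /\
  comparable (ZP k) (bar_image eps (@st_syz s)).
have step k s : exists s', (k < n)%N -> Inv k s ->
    Inv k.+1 s' /\ exists z, @linked s s' z.
  have [[lt_k [Zsp cmp]]|noInv] := pselect ((k < n)%N /\ Inv k s); last first.
    by exists s => lt_k Is; case: noInv.
  have [|t [N [NZ Ngen]]] := comparable_fg _ cmp (ZP_im k lt_k).
    move=> _ _ [x Zx ->] [y Zy ->]; exists (x + y); last by rewrite (barD grA connA epsP).
    by case: Zsp => + _ _ _ _; apply.
  have [q [D' [z [M [Zim Ksp ZM KM]]]]] := syzygy_step grA connA epsP tauP Zsp NZ Ngen.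
  exists (Stage D' (fun y => bihom z y = 0)) => _ _; split; last by exists z.
  split=> //=.
  have [f [g [H [fZ gZ HZ gfH]]]] := comparable_step cmp (ZP_im k lt_k) ZM.
  by exists f, g, H; split=> [u /fZ/KM|v /KM/gZ|v|v /KM/gfH] //; apply/KM/HZ.
have /choice[nxt nxtP] := fun ks : nat * stage => step ks.1 ks.2.
pose st := fix st k := if k is k'.+1 then nxt (k', st k') else
  @Stage 1 (fun=> 0%N) (fun x => bimul x = 0).
have st_inv k : (k <= n)%N -> Inv k (st k).
  elim: k => [_|k IHk lt_k]; last first.
    by case: (nxtP (k, st k) lt_k (IHk (ltnW lt_k))).
  split; first exact: bimul_ker_split.
  have [f [g [H [fZ gZ HZ gfH]]]] := comparable_augmentation pD pZ p_onto.
  exists f, g, H.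
  by split=> [u /fZ/bar_bimul_ker|v /bar_bimul_ker/gZ|v|v /bar_bimul_ker/gfH] //;
    apply/bar_bimul_ker/HZ.
have st_link k : exists z, (k < n)%N -> @linked (st k) (st k.+1) z.
  have [lt_k|_] := boolP (k < n)%N; last by exists (fun=> 0).
  by case: (nxtP (k, st k) lt_k (st_inv k (ltnW lt_k))) => _ [z zP]; exists z.
pose z k := projT1 (cid (st_link k)).
have zP k : (k < n)%N -> linked (z k) by exact: (projT2 (cid (st_link k))).
exists (fun k => st_rank (st k)), (fun k => freeB A (st_rank (st k))),
  (fun k i => bigen i 1 1), bimul, (fun k => bihom (z k)); split.
- by move=> k _; apply: freeB_free.
- by split=> [|k _]; [apply: bimul_hom | apply/bihom_hom/freeB_bimod].
- by move=> a; exists (bigen 0 a 1); rewrite bimul_gen mulr1.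
- by move=> n_gt0; case: (zP 0%N n_gt0).
- move=> k lt_k x; have [_ <-] := zP k (ltnW lt_k); have [+ _] := zP _ lt_k; apply.
Qed.

End BimoduleResolution.

Section Opposite.

Context (K : fieldType) (A : algType K).

Definition opalg : Type := A^c.
HB.instance Definition _ := GRing.NzRing.on opalg.

Fact opalg_scaleA (a b : K) (v : opalg) :
  a *: (b *: (v : A)) = ((a * b) *: (v : A)) :> opalg.
Proof. exact: scalerA. Qed.

HB.instance Definition _ := GRing.Zmodule_isLmodule.Build K opalg
  opalg_scaleA (@scale1r K A) (@scalerDr K A) (fun v a b => @scalerDl K A v a b).

Fact opalg_scaleAl (k : K) (x y : opalg) : k *: (x * y) = k *: x * y.
Proof. exact: (@scalerAr K A k y x). Qed.

HB.instance Definition _ := GRing.Lmodule_isLalgebra.Build K opalg opalg_scaleAl.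

Fact opalg_scaleAr (k : K) (x y : opalg) : k *: (x * y) = x * (k *: y).
Proof. exact: (@scalerAl K A k y x). Qed.

HB.instance Definition _ := GRing.Lalgebra_isAlgebra.Build K opalg opalg_scaleAr.

End Opposite.

Section OppositeTransfer.

Context (K : fieldType) (A : algType K).
Local Notation B := (opalg A : algType K).

Lemma opalg_graded (G : nat -> A -> Prop) :
  graded_algebra G -> @graded_algebra K B G.
Proof.
case=> sub dec inj mul; split=> // i j x y Gx Gy.
by rewrite addnC; apply: mul.
Qed.

Lemma opalg_right_FPn (eps : A -> K) n : right_FPn eps n -> @left_FPn K B eps n.
Proof.
move=> [r [p [d [pD pZ p_onto exact0 exactS]]]].
have mulT m1 m2 (v : 'M[A]_(m1, m2)) m3 (w : 'M[A]_(m2, m3)) :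
  (v *m w)^T = (w^T : 'M[B]_(_, _)) *m (v^T : 'M[B]_(_, _)).
  by rewrite -trmx_mul_rev.
have mulT' m1 m2 (v : 'M[B]_(m1, m2)) m3 (w : 'M[B]_(m2, m3)) :
  (v *m w)^T = (w^T : 'M[A]_(_, _)) *m (v^T : 'M[A]_(_, _)).
  by apply/matrixP => i j; rewrite !mxE; apply: eq_bigr => l _; rewrite !mxE.
exists r, (fun v : 'rV[B]_(r 0%N) => p (v^T : 'cV[A]_(r 0%N))),
  (fun k => (d k)^T : 'M[B]_(r k.+1, r k)); split.
- by move=> u v; rewrite -pD; congr p; apply/matrixP => i j; rewrite !mxE.
- move=> a v; rewrite [RHS]mulrC -pZ; congr p; apply/matrixP => i j.
  by rewrite !mxE big_ord1 !mxE (ord1 j).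
- by move=> k; have [v <-] := p_onto k; exists (v^T); rewrite trmxK.
- move=> n_gt0 v; rewrite exact0 //; split=> [[w e]|[w ->]].
    by exists (w^T); rewrite -mulT -e trmxK.
  by exists (w^T); rewrite mulT' trmxK.
- move=> k lt_k v.
  have -> : v *m ((d k)^T : 'M[B]_(_, _)) = 0 <-> d k *m (v^T : 'M[A]_(_, _)) = 0.
    split=> [/(congr1 trmx)|e].
      by rewrite mulT' trmxK => ->; apply/matrixP => i j; rewrite !mxE.
    apply: (can_inj (@trmxK _ _ _)); rewrite mulT' trmxK e.
    by apply/matrixP => i j; rewrite !mxE.
  rewrite exactS //; split=> [[w e]|[w ->]].
    by exists (w^T); rewrite -mulT -e trmxK.
  by exists (w^T); rewrite mulT' trmxK.
Qed.

Definition bimod_to_op (M : bimod_data A) : bimod_data B :=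
  @BimodData K B M (fun a m => @bm_r K A M m a) (fun m b => @bm_l K A M b m).

Definition bimod_of_op (M : bimod_data B) : bimod_data A :=
  @BimodData K A M (fun a m => @bm_r K B M m a) (fun m b => @bm_l K B M b m).

Lemma bimod_to_opP M : is_bimod M -> is_bimod (bimod_to_op M).
Proof.
case=> [[l1 l2 l3 l4] [r1 r2 r3 r4] lr lk]; split.
- by split=> // a b m; apply: r4.
- by split=> // a b m; apply: l4.
- by move=> a b m; rewrite /= lr.
- by move=> k m; apply/esym/lk.
Qed.

Lemma bimod_of_opP M : is_bimod M -> is_bimod (bimod_of_op M).
Proof.
case=> [[l1 l2 l3 l4] [r1 r2 r3 r4] lr lk]; split.
- by split=> // a b m; apply: r4.
- by split=> // a b m; apply: l4.
- by move=> a b m; rewrite /= lr.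
- by move=> k m; apply/esym/lk.
Qed.

Lemma bi_FPn_of_opalg n : bi_FPn B n -> bi_FPn A n.
Proof.
move=> [r [F [e [p [d [Ffree [pH dH] p_onto exact0 exactS]]]]]].
exists r, (fun k => bimod_of_op (F k)), e, p, d; split=> //; last first.
  split; first by case: pH => pD pL pR; split.
  by move=> k lt_k; case: (dH k lt_k) => dD dL dR; split.
move=> k le_k; have [Fb Fu] := Ffree k le_k; split; first exact: bimod_of_opP.
move=> N Nb nv; have [f [[fD fL fR] fe fu]] := Fu _ (bimod_to_opP Nb) nv.
exists f; split=> // g [gD gL gR] ge x; apply: fu => //; by split.
Qed.

End OppositeTransfer.

Theorem theorem4 (K : fieldType) (A : algType K) (G : nat -> A -> Prop)
    (eps : A -> K) (n : nat) :
  graded_algebra G -> connected_grading G -> standard_augmentation G eps ->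
  left_FPn eps n \/ right_FPn eps n ->
  bi_FPn A n.
Proof.
move=> grA connA epsP [lFP|/opalg_right_FPn rFP].
  have [tau tauP] := components_exist grA.
  exact: (left_FPn_bi_FPn grA connA epsP tauP).
have grB := opalg_graded grA; have [tau tauP] := components_exist grB.
exact/bi_FPn_of_opalg/(left_FPn_bi_FPn grB connA epsP tauP).
Qed.
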